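(* Let $m\in\mathbb{N}$ and $n=2$. Then the short exact sequence $$1\to B_m(\mathbb{R}P^2\setminus\{x_1,x_2\})\to B_{2,m}(\mathbb{R}P^2)\xrightarrow{\bar q} B_2(\mathbb{R}P^2)\to 1$$ splits, i.e. the homomorphism $\bar q$ admits a section (a homomorphism $s:B_2(\mathbb{R}P^2)\to B_{2,m}(\mathbb{R}P^2)$ with $\bar q\circ s=\mathrm{id}$).
   Context: For a surface $\Sigma$, $F_k(\Sigma)=\{(p_1,\dots,p_k)\in\Sigma^k: p_i\neq p_j \text{ for } i\neq j\}$ is the ordered configuration space, $B_k(\Sigma)=\pi_1(F_k(\Sigma)/S_k)$ is the $k$-string braid group of $\Sigma$, and $B_{n,m}(\Sigma)=\pi_1(F_{n+m}(\Sigma)/(S_n\times S_m))$, equivalently the subgroup of $B_{n+m}(\Sigma)$ consisting of the braids whose associated permutation lies in $S_n\times S_m\subset S_{n+m}$. The homomorphism $\bar q:B_{n,m}(\mathbb{R}P^2)\to B_n(\mathbb{R}P^2)$ is induced by the fibration $q:F_{n+m}(\mathbb{R}P^2)/(S_n\times S_m)\to F_n(\mathbb{R}P^2)/S_n$ forgetting the last $m$ points (geometrically, forgetting the last $m$ strands); its kernel is $B_m(\mathbb{R}P^2\setminus\{x_1,\dots,x_n\})$, giving the generalised Fadell--Neuwirth short exact sequence $1\to B_m(\mathbb{R}P^2\setminus\{x_1,\dots,x_n\})\to B_{n,m}(\mathbb{R}P^2)\xrightarrow{\bar q} B_n(\mathbb{R}P^2)\to 1$. *)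

(* Defs.v *)
From HB Require Import structures.
From mathcomp Require Import all_boot all_order all_algebra all_fingroup generic_quotient.
From mathcomp Require Import all_classical all_reals all_analysis.
Import numFieldTopology.Exports numFieldNormedType.Exports.
Import GRing.Theory Num.Theory.


Unset Strict Implicit.
Unset Printing Implicit Defensive.

Local Open Scope ring_scope.
Local Open Scope classical_set_scope.
Local Open Scope quotient_scope.

Definition sphere2 (R : realType) : set 'rV[R]_3 :=
  [set x | \sum_(i < 3) x ord0 i ^+ 2 = 1].

Definition S2 (R : realType) : topologicalType := set_type (sphere2 R).

Definition antip_rel (R : realType) : rel (S2 R) :=
  fun x y => (sval x == sval y) || (sval x == - sval y).

Lemma antip_refl R : reflexive (@antip_rel R).
Proof. by move=> x; rewrite /antip_rel eqxx. Qed.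

Lemma antip_sym R : symmetric (@antip_rel R).
Proof.
move=> x y; rewrite /antip_rel [sval y == _]eq_sym; congr (_ || _).
by apply/eqP/eqP => ->; rewrite opprK.
Qed.

Lemma antip_trans R : transitive (@antip_rel R).
Proof.
move=> y x z; rewrite /antip_rel.
by case/orP => /eqP ->; case/orP => /eqP ->; rewrite ?opprK eqxx ?orbT.
Qed.

Definition antip_equiv R : equiv_rel (S2 R) :=
  EquivRel (@antip_rel R) (@antip_refl R) (@antip_sym R) (@antip_trans R).

Definition RP2 (R : realType) : topologicalType :=
  quotient_topology {eq_quot (antip_equiv R)}.

Definition FConf (R : realType) (k : nat) : topologicalType :=
  set_type [set p : prod_topology (fun _ : 'I_k => RP2 R) |
    injective (p : 'I_k -> RP2 R)].

Definition orb_rel (R : realType) (k : nat) (G : {group {perm 'I_k}}) :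
  rel (FConf R k) :=
  fun p q => `[< exists2 s, s \in G & forall i, sval q i = sval p (s i)>].

Lemma orb_refl R k G : reflexive (@orb_rel R k G).
Proof. by move=> p; apply/asboolP; exists 1%g => // i; rewrite perm1. Qed.

Lemma orb_sym R k G : symmetric (@orb_rel R k G).
Proof.
suff H : forall p q, orb_rel R k G p q -> orb_rel R k G q p.
  by move=> p q; apply/idP/idP => /H.
move=> p q /asboolP [s sG E]; apply/asboolP; exists s^-1%g; first by rewrite groupV.
by move=> i; rewrite E permKV.
Qed.

Lemma orb_trans R k G : transitive (@orb_rel R k G).
Proof.
move=> q p r /asboolP [s sG E1] /asboolP [t tG E2]; apply/asboolP.
exists (t * s)%g; first by rewrite groupM.
by move=> i; rewrite E2 E1 permM.
Qed.

Definition orb_equiv R k G : equiv_rel (FConf R k) :=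
  EquivRel (@orb_rel R k G) (@orb_refl R k G) (@orb_sym R k G) (@orb_trans R k G).

(* The Young subgroup S_n x S_m of S_(n+m): permutations preserving the
   set of the first n indices (hence also the last m). *)
Definition young (n m : nat) : {group {perm 'I_(n + m)}} :=
  'N([set i : 'I_(n + m) | (i < n)%N] | 'P)%G.

Definition Conf (R : realType) (n m : nat) : topologicalType :=
  quotient_topology {eq_quot (orb_equiv R (n + m) (young n m))}.

Definition UConf (R : realType) (n : nat) : topologicalType :=
  quotient_topology {eq_quot (orb_equiv R n [group of [set: {perm 'I_n}]])}.

Lemma restr_inj R n m (p : FConf R (n + m)) :
  [set f : 'I_n -> RP2 R | injective f] (fun i => sval p (lshift m i)).
Proof.
case: p => f /= /set_mem finj i j /finj /(congr1 val) /= ij.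
exact: val_inj.
Qed.

Definition restr R n m (p : FConf R (n + m)) : FConf R n :=
  exist _ (fun i => sval p (lshift m i)) (mem_set (restr_inj R n m p)).

Definition forget (R : realType) (n m : nat) (c : Conf R n m) : UConf R n :=
  \pi_(UConf R n) (restr R n m (repr c)).

Definition loop (R : realType) (X : topologicalType) (x0 : X) (f : R -> X) :=
  {within `[0, 1], continuous f} /\ f 0 = x0 /\ f 1 = x0.

Definition homotopic (R : realType) (X : topologicalType) (x0 : X)
    (f g : R -> X) :=
  exists H : R * R -> X,
    {within `[0, 1] `*` `[0, 1], continuous H} /\
    (forall s, s \in `[0, 1] -> H (s, 0) = f s /\ H (s, 1) = g s) /\
    (forall t, t \in `[0, 1] -> H (0, t) = x0 /\ H (1, t) = x0).

Definition concat (R : realType) (X : Type) (f g : R -> X) : R -> X :=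
  fun s => if s <= 2^-1 then f (2 * s) else g (2 * s - 1).
Arguments concat {R X}.

Arguments loop {R X}.
Arguments homotopic {R X}.

(* A homomorphism pi_1(Y, y0) -> pi_1(X, x0) presented on representatives:
   phi sends loops to loops, respects homotopy and products.
   [pi1_section_of q y0 s] says: s induces a homomorphism
   pi_1(X, q y0) -> pi_1(Y, y0) with pi_1(q) o s = id. *)
Definition pi1_hom (R : realType) (X Y : topologicalType) (x0 : X) (y0 : Y)
    (phi : (R -> X) -> (R -> Y)) :=
  [/\ forall f, loop x0 f -> loop y0 (phi f),
      forall f g, loop x0 f -> loop x0 g -> homotopic x0 f g ->
        homotopic y0 (phi f) (phi g)
    & forall f g, loop x0 f -> loop x0 g ->
        homotopic y0 (phi (concat f g)) (concat (phi f) (phi g))].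

Arguments pi1_hom {R X Y}.

Definition pi1_section (R : realType) (X Y : topologicalType) (q : Y -> X)
    (y0 : Y) (s : (R -> X) -> (R -> Y)) :=
  pi1_hom (q y0) y0 s /\
  forall f, loop (q y0) f -> homotopic (q y0) (q \o s f) f.
Arguments pi1_section {R X Y}.

(* Main.v *)
Require Import Defs.
From HB Require Import structures.
From mathcomp Require Import all_boot all_order all_algebra all_fingroup generic_quotient.
From mathcomp Require Import all_classical all_reals all_analysis.
From mathcomp Require Import ring lra zify.
Import Order.TTheory GRing.Theory Num.Theory.
Import numFieldTopology.Exports numFieldNormedType.Exports.

(** The map [forget] has a genuine continuous section.  Given two distinct lines
    spanned by unit vectors u, v, put w = u x v.  The lines spanned by w, the pair
    u + v, u - v, and the quadruples u + t w, u - t w, v + t w, v - t w (t > 0) are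
    permuted among themselves when u or v changes sign and when u and v are
    exchanged, so for every m a union of such families gives m further lines
    depending only on the unordered pair, and continuously on it.  The base point
    is corrected by conjugating with a path inside the fibre, which exists because
    m distinct points of RP^2 minus two points can be moved one at a time along
    generic projective segments. *)

Set Implicit Arguments.
Unset Strict Implicit.
Unset Printing Implicit Defensive.

Local Open Scope ring_scope.
Local Open Scope classical_set_scope.
Local Open Scope quotient_scope.

(** * Continuity and conjugated loops *)

(** Loops are continuous only within [0, 1]; precomposing with a map into that set, such as [clamp],
    gives global continuity. *)
Lemma within_continuous_compT (T U V : topologicalType) (A : set U)
    (f : U -> V) (c : T -> U) :
  {within A, continuous f} -> continuous c -> (forall t, A (c t)) ->
  continuous (f \o c).
Proof.
move=> /subspace_continuousP fA cc Ac t W /= /(fA _ (Ac t)) fW.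
have := cc t _ fW; rewrite nbhs_simpl /=.
by apply: filterS => x /=; apply.
Qed.

Lemma continuous_glue (R : realType) (T X : topologicalType) (h : T -> R)
    (a : R) (f g : T -> X) :
  continuous h -> continuous f -> continuous g ->
  (forall t, h t = a -> f t = g t) ->
  continuous (fun t => if h t <= a then f t else g t).
Proof.
move=> ch cf cg fg t W /=.
have [hta|hta|hta] := ltgtP (h t) a.
- move=> /cf /= fW; have := ch t _ (lt_nbhsl hta); rewrite !nbhs_simpl /= in fW *.
  apply: filter_app; apply: filterS fW => x /= Wx hx.
  by rewrite /= ltW.
- move=> /cg /= fW; have := ch t _ (lt_nbhsr hta); rewrite !nbhs_simpl /= in fW *.
  apply: filter_app; apply: filterS fW => x /= Wx hx.
  by rewrite /= leNgt hx.
- move=> Wt; have /= fW := cf t _ Wt; rewrite (fg _ hta) in Wt.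
  have := cg t _ Wt; rewrite !nbhs_simpl /= in fW *.
  apply: filter_app; apply: filterS fW => x /= Wf Wg.
  by case: ifP.
Qed.

Lemma continuous_pair (T U V : topologicalType) (f : T -> U) (g : T -> V) :
  continuous f -> continuous g -> continuous (fun t => (f t, g t)).
Proof. by move=> cf cg t; exact: (cvg_pair (cf t) (cg t)). Qed.

Ltac lra_minmax :=
  rewrite ?maxEle ?minEle;
  repeat match goal with |- context [if ?b then _ else _] =>
    lazymatch b with context [if _ then _ else _] => fail | _ => case: (boolP b) => ? end
  end;
  lra.

Section clamp.
Context (R : realType).

Definition clamp (x : R) : R := Num.max 0 (Num.min x 1).

Lemma clamp_itv x : `[0, 1]%classic (clamp x).
Proof. by rewrite /= in_itv /= /clamp; lra_minmax. Qed.

Lemma clamp_id x : 0 <= x <= 1 -> clamp x = x.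
Proof. by rewrite /clamp; lra_minmax. Qed.

Lemma clamp_le0 x : x <= 0 -> clamp x = 0.
Proof. by rewrite /clamp; lra_minmax. Qed.

Lemma clamp_ge1 x : 1 <= x -> clamp x = 1.
Proof. by rewrite /clamp; lra_minmax. Qed.

Lemma continuous_clamp : continuous clamp.
Proof.
apply: max_fun_continuous; first exact: cst_continuous.
by apply: min_fun_continuous; [move=> x; exact: cvg_id|exact: cst_continuous].
Qed.
End clamp.

(** * Lifting loops through a section, conjugated by a path in the fibre *)

Section section_pi1.
Context (R : realType) (X Y : topologicalType) (q : Y -> X) (y0 : Y).
Context (sigma : X -> Y) (gamma : R -> Y).
Context (csigma : continuous sigma) (sigmaK : cancel sigma q).
Context (cgamma : continuous gamma) (gamma0 : gamma 0 = y0).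
Context (gamma1 : gamma 1 = sigma (q y0)).
Context (q_gamma : forall t, q (gamma t) = q y0).

Let x0 := q y0.

(** Time runs over [-1, 2]: [gamma], then a lifted point, then [gamma] reversed. The point [x] is a
    separate argument so that loops and homotopies share this formula. *)
Let tail (y : R) (x : X) : Y :=
  if y <= 0 then gamma (1 + y) else
  if y <= 1 then sigma x else gamma (2 - y).

(** The pieces meet at times 0 and 1, where [x] is [x0] and both sides are [gamma 1 = sigma x0]. *)
Let continuous_tail (T : topologicalType) (y : T -> R) (x : T -> X) :
    continuous y -> continuous x ->
    (forall t, y t = 0 \/ y t = 1 -> x t = x0) ->
  continuous (fun t => tail (y t) (x t)).
Proof.
move=> cy cx yx; apply: (continuous_glue cy).
- move=> t; apply: continuous_comp; last exact: cgamma.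
  by apply: cvgD; [exact: cvg_cst|exact: cy].
- apply: (continuous_glue cy).
  + by move=> t; apply: continuous_comp; [exact: cx|exact: csigma].
  + move=> t; apply: continuous_comp; last exact: cgamma.
    by apply: cvgB; [exact: cvg_cst|exact: cy].
  + by move=> t yt; rewrite yt yx ?yt; [rewrite (_ : 2 - 1 = 1 :> R) //; lra|right].
- by move=> t yt; rewrite yt ler01 addr0 gamma1 yx ?yt //; left.
Qed.

Let E (f : R -> X) (y : R) := tail y (f (clamp y)).

(** The map [x |-> 3 * x - 1] carries [0, 1] onto the time interval [-1, 2]: [gamma], [sigma \o f]
    and the reversed [gamma] take a third each. *)
Definition lift_loop (f : R -> X) (x : R) := E f (3 * x - 1).

Let continuous_clamped f : loop x0 f -> continuous (f \o @clamp R).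
Proof.
move=> [cf _]; apply: (within_continuous_compT cf); first exact: continuous_clamp.
exact: clamp_itv.
Qed.

Let continuous_E f : loop x0 f -> continuous (E f).
Proof.
move=> lf; have cf := continuous_clamped lf; case: lf => _ [f0 f1].
apply: (@continuous_tail R id (f \o @clamp R)) => //; first by move=> t; exact: cvg_id.
by move=> t [] -> /=; rewrite clamp_id //; lra.
Qed.

Let E_le0 f y : y <= 0 -> E f y = gamma (1 + y).
Proof. by rewrite /E /tail => ->. Qed.

Let E_ge1 f y : loop x0 f -> 1 <= y -> E f y = gamma (2 - y).
Proof.
move=> [_ [_ f1]] y1; rewrite /E /tail leNgt (lt_le_trans ltr01 y1) /=.
case: ifP => // y1'; have -> : y = 1 by lra.
rewrite clamp_id; last by lra.
by rewrite f1 -gamma1; congr gamma; lra.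
Qed.

Let E_m1 f : E f (-1) = y0.
Proof. by rewrite E_le0 ?subrr ?gamma0 //; lra. Qed.

Let E_2 f : loop x0 f -> E f 2 = y0.
Proof. by move=> lf; rewrite E_ge1 ?subrr ?gamma0 //; lra. Qed.

Let continuous_lift f : loop x0 f -> continuous (lift_loop f).
Proof.
move=> lf x.
apply: (@continuous_comp R R Y (fun x : R => 3 * x - 1) (E f) x); last exact: continuous_E.
apply: cvgB; last exact: cvg_cst.
by apply: cvgM; [exact: cvg_cst|exact: cvg_id].
Qed.

Let lift_loop_loop f : loop x0 f -> loop y0 (lift_loop f).
Proof.
move=> lf; split; first by apply: continuous_subspaceT; exact: continuous_lift.
split; rewrite /lift_loop; first by rewrite mulr0 sub0r E_m1.
by rewrite (_ : 3 * 1 - 1 = 2 :> R) ?E_2 //; lra.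
Qed.

Let lift_loop_homotopic f g : loop x0 f -> loop x0 g ->
  homotopic x0 f g -> homotopic y0 (lift_loop f) (lift_loop g).
Proof.
move=> lf lg [H [cH [H01 Hx0]]].
(* The homotopy acts on the middle third only; clamping both of its arguments makes it continuous on
   the whole plane. *)
exists (fun z => tail (3 * z.1 - 1) (H (clamp (3 * z.1 - 1), clamp z.2))).
have cy : continuous (fun z : R * R => 3 * z.1 - 1).
  move=> z; apply: cvgB; last exact: cvg_cst.
  by apply: cvgM; [exact: cvg_cst|exact: cvg_fst].
have in01 (x : R) : clamp x \in `[0, 1] by apply/mem_set; apply: clamp_itv.
split.
  apply: continuous_subspaceT; apply: continuous_tail => //.
    apply: (within_continuous_compT cH) => [|z].
      apply: continuous_pair => z; apply: cvg_comp; try exact: continuous_clamp.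
        exact: cy.
      exact: cvg_snd.
    by split; exact: clamp_itv.
  move=> t [] ->.
    by rewrite (@clamp_le0 _ 0) //; have [] := Hx0 _ (in01 t.2).
  by rewrite (@clamp_ge1 _ 1) //; have [] := Hx0 _ (in01 t.2).
split=> [s s01|t t01] /=.
  rewrite (@clamp_le0 _ 0) // (@clamp_ge1 _ 1) //.
  by have [-> ->] := H01 _ (in01 (3 * s - 1)).
rewrite mulr0 sub0r (_ : 3 * 1 - 1 = 2 :> R); last by lra.
rewrite clamp_le0 ?(@clamp_ge1 _ 2); [|lra|lra].
have [-> ->] := Hx0 _ (in01 t).
rewrite /tail; split; first by rewrite ifT ?subrr ?gamma0 //; lra.
by rewrite ifF ?ifF ?subrr ?gamma0 //; apply/negbTE; lra.
Qed.

(* The middle detour gamma^-1 * gamma is retracted along gamma while both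
   halves are reparametrised linearly. *)
Let lift_loop_concat f g : loop x0 f -> loop x0 g ->
  homotopic y0 (lift_loop (concat f g)) (concat (lift_loop f) (lift_loop g)).
Proof.
move=> lf lg.
(* At [t = 0] the times [al] and [be] run through the lift of the concatenation, at [t = 1] through
   the concatenation of the lifts. At [x = 2^-1] they are [1 + t] and [- t], where [E f] and [E g]
   are both [gamma (1 - t)]. *)
pose al (x t : R) := (1 - t) * (3 * x - 1 + Num.max (3 * x - 1) 0) + t * (6 * x - 1).
pose be (x t : R) :=
  (1 - t) * Num.min (2 * (3 * x - 1) - 1) (3 * x - 1) + t * (6 * x - 4).
pose c2 : R * R -> R := fun z => clamp z.2.
have c_c2 : continuous c2.
  by move=> z; apply: cvg_comp; [exact: cvg_snd|exact: continuous_clamp].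
have c1 (a b : R) : continuous (fun z : R * R => a * z.1 - b).
  move=> z; apply: cvgB; last exact: cvg_cst.
  by apply: cvgM; [exact: cvg_cst|exact: cvg_fst].
have interp (u v : R * R -> R) : continuous u -> continuous v ->
    continuous (fun z => (1 - c2 z) * u z + c2 z * v z).
  move=> cu cv z; apply: cvgD; apply: cvgM.
  - by apply: cvgB; [exact: cvg_cst|exact: c_c2].
  - exact: cu.
  - exact: c_c2.
  - exact: cv.
exists (fun z => if z.1 <= 2^-1 then E f (al z.1 (c2 z)) else E g (be z.1 (c2 z))).
have ez t : 0 <= t <= 1 -> E f (al 2^-1 t) = E g (be 2^-1 t).
  move=> t01; have -> : al 2^-1 t = 1 + t by rewrite /al; lra_minmax.
  have -> : be 2^-1 t = - t by rewrite /be; lra_minmax.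
  by rewrite E_ge1 // ?E_le0; [congr gamma; lra|lra|lra].
split.
  apply: continuous_subspaceT; apply: continuous_glue.
  - by move=> z; exact: cvg_fst.
  - move=> z; apply: (@continuous_comp _ _ _ (fun z => al z.1 (c2 z)) (E f));
      last exact: continuous_E.
    apply: interp => // w; apply: cvgD; first exact: c1.
    by move: w; apply: max_fun_continuous; [exact: c1|exact: cst_continuous].
  - move=> z; apply: (@continuous_comp _ _ _ (fun z => be z.1 (c2 z)) (E g));
      last exact: continuous_E.
    apply: interp => //; apply: min_fun_continuous; last exact: c1.
    move=> w; apply: cvgB; last exact: cvg_cst.
    by apply: cvgM; [exact: cvg_cst|exact: c1].
  - by move=> z ->; apply: ez; have := clamp_itv z.2; rewrite /= in_itv.
split=> [s /set_mem|t t01] /=.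
  rewrite in_itv /= => s01.
  have -> : c2 (s, 0) = 0 by rewrite /c2 clamp_le0.
  have -> : c2 (s, 1) = 1 by rewrite /c2 clamp_ge1.
  split.
    have -> : al s 0 = 3 * s - 1 + Num.max (3 * s - 1) 0 by rewrite /al; lra_minmax.
    have -> : be s 0 = Num.min (2 * (3 * s - 1) - 1) (3 * s - 1) by rewrite /be; lra_minmax.
    rewrite /lift_loop; set y := 3 * s - 1.
    (* The map [s |-> 3 * s - 1] fixes 1/2, so both sides pass from [f] to [g] at the same time. *)
    have -> : (s <= 2^-1) = (y <= 2^-1) by rewrite /y; apply/idP/idP; lra.
    have y01 : -1 <= y <= 2 by rewrite /y; lra_minmax.
    rewrite {3}/E /tail /concat.
    case: ifPn => y2.
      case: ifPn => y0'.
        have -> : y + Num.max y 0 = y by lra_minmax.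
        by rewrite E_le0.
      have -> : y + Num.max y 0 = 2 * y by lra_minmax.
      rewrite /E /tail !clamp_id; [|lra|lra].
      rewrite y2 (_ : (2 * y <= 0) = false); last by apply/negbTE; lra.
      by rewrite !ifT //; lra.
    rewrite ifF; last by apply/negbTE; lra.
    case: ifPn => y1.
      have -> : Num.min (2 * y - 1) y = 2 * y - 1 by lra_minmax.
      rewrite /E /tail !clamp_id; [|lra|lra].
      rewrite (negbTE y2) (_ : (2 * y - 1 <= 0) = false); last by apply/negbTE; lra.
      by rewrite !ifT //; lra.
    have -> : Num.min (2 * y - 1) y = y by lra_minmax.
    by rewrite E_ge1 //; lra.
  have -> : al s 1 = 3 * (2 * s) - 1 by rewrite /al; lra_minmax.
  have -> : be s 1 = 3 * (2 * s - 1) - 1 by rewrite /be; lra_minmax.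
  by [].
rewrite /c2 /=.
have := clamp_itv t; rewrite /= in_itv /=; set t' := clamp t => t'01.
rewrite ifT ?ifF; [|apply/negbTE; lra|lra].
have -> : al 0 t' = -1 by rewrite /al; lra_minmax.
have -> : be 1 t' = 2 by rewrite /be; lra_minmax.
by rewrite E_m1 E_2.
Qed.

Let lift_loopK f : loop x0 f -> homotopic x0 (q \o lift_loop f) f.
Proof.
move=> lf.
(* Since [gamma] projects to the base point, the projected lift is [f] at time [clamp (3 * x - 1)];
   this time is deformed linearly to [x]. The ends stay at or below 0 and at or above 1 before
   clamping. *)
exists (fun z => f (clamp ((1 - z.2) * (3 * z.1 - 1) + z.2 * z.1))).
split.
  apply: continuous_subspaceT => z.
  apply: (@continuous_comp _ R X
    (fun z : R * R => (1 - z.2) * (3 * z.1 - 1) + z.2 * z.1) (f \o @clamp R));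
    last exact: continuous_clamped.
  apply: cvgD; apply: cvgM; try exact: cvg_snd; try exact: cvg_fst.
    by apply: cvgB; [exact: cvg_cst|exact: cvg_snd].
  apply: cvgB; last exact: cvg_cst.
  by apply: cvgM; [exact: cvg_cst|exact: cvg_fst].
case: (lf) => _ [f0 f1].
split=> [s|t] /set_mem /=; rewrite in_itv /= => h.
  split; last by rewrite subrr mul0r add0r mul1r clamp_id.
  rewrite subr0 mul1r mul0r addr0 /lift_loop /E /tail.
  case: ifPn => h0; first by rewrite q_gamma clamp_le0.
  case: ifPn => h1; first by rewrite sigmaK.
  by rewrite q_gamma clamp_ge1 //; lra.
rewrite clamp_le0 ?clamp_ge1 //; first nra.
nra.
Qed.

Lemma pi1_section_lift_loop : pi1_section q y0 lift_loop.
Proof. by split; [split|]. Qed.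

End section_pi1.

(** * Vectors of R^3 and lines *)

Lemma continuous_subtype (T X : topologicalType) (A : set X)
    (f : T -> set_type A) t :
  {for t, continuous (fun s => sval (f s))} -> {for t, continuous f}.
Proof.
move=> cf W [_ [[C oC <-] Cf] CW].
by have := cf C (open_nbhs_nbhs (conj oC Cf)); rewrite !nbhs_simpl /=; apply: filterS => s /CW.
Qed.

Lemma continuous_sval (X : topologicalType) (A : set X) :
  continuous (fun p : set_type A => sval p : X).
Proof. exact: (@initial_continuous (set_type A) X set_val). Qed.

Lemma continuous_prod (T : topologicalType) (I : Type) (K : I -> topologicalType)
    (f : T -> prod_topology K) t :
  (forall i, {for t, continuous (fun s => f s i)}) -> {for t, continuous f}.
Proof.
move=> cf; apply/cvg_sup => i W [_ [[C oC <-] Cf] CW].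
by have := cf i C (open_nbhs_nbhs (conj oC Cf)); rewrite !nbhs_simpl /=; apply: filterS => s /CW.
Qed.

Section vectors.
Context (R : realType).
Implicit Types (x y z u v : 'rV[R]_3) (a b c : R).

Notation i0 := (@Ordinal 3 0 isT).
Notation i1 := (@Ordinal 3 1 isT).
Notation i2 := (@Ordinal 3 2 isT).

Lemma sum3E (F : 'I_3 -> R) : \sum_i F i = F i0 + F i1 + F i2.
Proof.
rewrite !big_ord_recl big_ord0 addr0 addrA.
by congr (_ + _ + _); congr F; apply: val_inj.
Qed.

Lemma row3P x y : x ord0 i0 = y ord0 i0 -> x ord0 i1 = y ord0 i1 ->
  x ord0 i2 = y ord0 i2 -> x = y.
Proof.
move=> h0 h1 h2; apply/rowP => -[[|[|[|//]]] h].
- by rewrite (_ : Ordinal h = i0) //; apply: val_inj.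
- by rewrite (_ : Ordinal h = i1) //; apply: val_inj.
- by rewrite (_ : Ordinal h = i2) //; apply: val_inj.
Qed.

Definition dot x y : R := \sum_i x ord0 i * y ord0 i.

Definition cross x y : 'rV[R]_3 := \row_i
  [:: x ord0 i1 * y ord0 i2 - x ord0 i2 * y ord0 i1;
      x ord0 i2 * y ord0 i0 - x ord0 i0 * y ord0 i2;
      x ord0 i0 * y ord0 i1 - x ord0 i1 * y ord0 i0]`_i.

Lemma dotE x y : dot x y = x ord0 i0 * y ord0 i0 + x ord0 i1 * y ord0 i1
  + x ord0 i2 * y ord0 i2.
Proof. exact: sum3E. Qed.

Lemma dotC x y : dot x y = dot y x.
Proof. by rewrite !dotE; ring. Qed.

Lemma dotDl x y z : dot (x + y) z = dot x z + dot y z.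
Proof. by rewrite !dotE !mxE; ring. Qed.

Lemma dotZl a x y : dot (a *: x) y = a * dot x y.
Proof. by rewrite !dotE !mxE; ring. Qed.

Lemma dot_crossl x y : dot x (cross x y) = 0.
Proof. by rewrite !dotE !mxE /=; ring. Qed.

Lemma dot_crossr x y : dot y (cross x y) = 0.
Proof. by rewrite !dotE !mxE /=; ring. Qed.

Lemma dot_cross_cross x y :
  dot (cross x y) (cross x y) = dot x x * dot y y - dot x y ^+ 2.
Proof. by rewrite !dotE !mxE /=; ring. Qed.

Lemma crossC x y : cross x y = - cross y x.
Proof. by apply: row3P; rewrite !mxE /=; ring. Qed.

Lemma crossNl x y : cross (- x) y = - cross x y.
Proof. by apply: row3P; rewrite !mxE /=; ring. Qed.

Lemma dotxx_eq0 x : (dot x x == 0) = (x == 0).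
Proof.
apply/eqP/eqP => [|->]; last by rewrite dotE !mxE; ring.
by rewrite dotE => h; apply: row3P; rewrite !mxE; nra.
Qed.

Lemma dotxx_ge0 x : 0 <= dot x x.
Proof. by rewrite dotE; nra. Qed.

Lemma dotxx_gt0 x : x != 0 -> 0 < dot x x.
Proof. by move=> x0; rewrite lt_neqAle eq_sym dotxx_eq0 x0 dotxx_ge0. Qed.

(** The triple product formula for [cross (cross x y) x] expresses a nonzero multiple of [y] through
    [x]. *)
Lemma cross_eq0 x y : x != 0 -> cross x y = 0 -> y = (dot x y / dot x x) *: x.
Proof.
move=> x0 xy; have d0 := dotxx_gt0 x0.
have h : dot x x *: y - dot x y *: x = cross (cross x y) x.
  by apply: row3P; rewrite !mxE /= !dotE; ring.
move: h; rewrite xy (_ : cross 0 x = 0); last by apply: row3P; rewrite !mxE /=; ring.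
move=> /subr0_eq h; apply: (scalerI (lt0r_neq0 d0)).
by rewrite h scalerA mulrCA divff ?mulr1 // lt0r_neq0.
Qed.

(* Plane [n^perp] meets the curve [(1, s, s^2)] at roots of a quadratic. *)
Lemma generic_vector (ns : seq 'rV[R]_3) : 0 \notin ns ->
  exists z, forall n, n \in ns -> dot z n != 0.
Proof.
move=> ns0.
pose pol (n : 'rV[R]_3) : {poly R} := Poly [:: n ord0 i0; n ord0 i1; n ord0 i2].
pose p := \prod_(n <- ns) pol n.
have p0 : p != 0.
  rewrite prodf_seq_neq0; apply/allP => n nns /=.
  apply: contra ns0 => /eqP pn; suff <- : n = 0 by [].
  have co k : (pol n)`_k = 0 by rewrite pn coef0.
  have := co 0%N; have := co 1%N; have := co 2%N; rewrite !coef_Poly /= => h2 h1 h0.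
  by apply: row3P; rewrite !mxE.
(* A nonzero polynomial cannot vanish at the [size p] distinct naturals 0, 1, ..., since [size p]
   exceeds its degree. *)
have [s ps] : exists s : R, ~~ root p s.
  apply: contrapT => /forallNP h.
  have := @max_poly_roots _ p [seq k%:R | k <- iota 0 (size p)] p0.
  rewrite size_map size_iota ltnn => h'; suff: false by [].
  apply: h'; first by apply/allP => s _; apply: contrapT => /negP; exact: h.
  by rewrite map_inj_uniq ?iota_uniq // => j k /eqP; rewrite eqr_nat => /eqP.
exists (\row_i s ^+ i) => n nns.
apply: contra ps => /eqP zn.
rewrite /p /root horner_prod prodf_seq_eq0; apply/hasP; exists n => //=.
rewrite -zn dotE !mxE /= horner_Poly /= expr0 expr1; apply/eqP; ring.
Qed.

(** The Gram determinant [1 - dot x y ^+ 2] is nonzero, since equality in Cauchy-Schwarz would force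
    [x = y] or [x = - y]. Pairing the relation with [x], [y] and [cross x y] then kills the
    coefficients. *)
Lemma frame_free x y a b c : dot x x = 1 -> dot y y = 1 -> x != y -> x != - y ->
  a *: x + b *: y + c *: cross x y = 0 -> [/\ a = 0, b = 0 & c = 0].
Proof.
move=> xx yy xy xNy h.
have dP (e : R) : e ^+ 2 = 1 -> dot x y = e -> x = e *: y.
  move=> e1 xye; apply/subr0_eq/eqP; rewrite -dotxx_eq0.
  have -> : dot (x - e *: y) (x - e *: y) = dot x x - 2 * e * dot x y + e ^+ 2 * dot y y.
    by rewrite !dotE !mxE; ring.
  by rewrite xx yy xye e1; apply/eqP; nra.
have d1 : dot x y ^+ 2 != 1.
  rewrite sqrf_eq1; apply/norP; split.
    apply: contra xy => /eqP h1; apply/eqP.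
    by rewrite {1}(dP _ _ h1) ?scale1r // expr1n.
  apply: contra xNy => /eqP h1; apply/eqP.
  by rewrite {1}(dP _ _ h1) ?scaleN1r // sqrrN expr1n.
have hz z : a * dot x z + b * dot y z + c * dot (cross x y) z = 0.
  by rewrite -!dotZl -!dotDl h -(scale0r 0) dotZl mul0r.
have := hz x; have := hz y; have := hz (cross x y).
rewrite dot_cross_cross dot_crossl dot_crossr !(dotC (cross x y)) dot_crossl.
rewrite dot_crossr xx yy !mulr0 !mulr1 !add0r !addr0 (dotC y x) => h1 h2 h3.
have {}d1 : 1 - dot x y ^+ 2 != 0 by rewrite subr_eq0 eq_sym.
have c0 : c = 0 by apply: (mulIf d1); rewrite mul0r.
have b0 : b = 0.
  apply: (mulIf d1); rewrite mul0r.
  have -> : b * (1 - dot x y ^+ 2) = (a * dot x y + b) - dot x y * (a + b * dot x y) by ring.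
  by rewrite h2 h3 mulr0 subrr.
by split=> //; move: h3; rewrite b0; lra.
Qed.

Lemma continuous_row (T : topologicalType) (f : T -> 'rV[R]_3) t :
  (forall i, {for t, continuous (fun s => f s ord0 i)}) -> {for t, continuous f}.
Proof.
move=> cf W [P nP PW] /=; rewrite nbhs_simpl /=.
have : \forall s \near t, forall i, P ord0 i (f s ord0 i).
  by apply: filter_forall => i; exact: (cf i _ (nP ord0 i)).
by apply: filterS => s Ps; apply: PW => i j; rewrite ord1; exact: Ps.
Qed.

Lemma continuous_dot (T : topologicalType) (f g : T -> 'rV[R]_3) t :
  {for t, continuous f} -> {for t, continuous g} ->
  {for t, continuous (fun s => dot (f s) (g s))}.
Proof.
move=> cf cg; have co (h : T -> 'rV[R]_3) i : {for t, continuous h} ->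
    {for t, continuous (fun s => h s ord0 i)}.
  move=> ch; apply: (@continuous_comp _ _ _ h (fun x => x ord0 i)) => //.
  exact: coord_continuous.
have -> : (fun s => dot (f s) (g s)) = (fun s => f s ord0 i0 * g s ord0 i0 +
    f s ord0 i1 * g s ord0 i1 + f s ord0 i2 * g s ord0 i2).
  by apply/funext => s; rewrite dotE.
by apply: cvgD; [apply: cvgD|]; apply: cvgM; exact: co.
Qed.

Lemma continuous_cross (T : topologicalType) (f g : T -> 'rV[R]_3) t :
  {for t, continuous f} -> {for t, continuous g} ->
  {for t, continuous (fun s => cross (f s) (g s))}.
Proof.
move=> cf cg; have co (h : T -> 'rV[R]_3) i : {for t, continuous h} ->
    {for t, continuous (fun s => h s ord0 i)}.
  move=> ch; apply: (@continuous_comp _ _ _ h (fun x => x ord0 i)) => //.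
  exact: coord_continuous.
have cc i j : {for t, continuous (fun s => f s ord0 i * g s ord0 j - f s ord0 j * g s ord0 i)}.
  by apply: cvgB; apply: cvgM; exact: co.
have ccE k i j : (forall s, cross (f s) (g s) ord0 k =
    f s ord0 i * g s ord0 j - f s ord0 j * g s ord0 i) ->
    {for t, continuous (fun s => cross (f s) (g s) ord0 k)}.
  by move=> /funext ->; exact: cc.
apply: continuous_row => -[[|[|[|//]]] h].
- by apply: (ccE _ i1 i2) => s; rewrite mxE.
- by apply: (ccE _ i2 i0) => s; rewrite mxE.
- by apply: (ccE _ i0 i1) => s; rewrite mxE.
Qed.

(** * Normalisation of vectors and the projection onto the projective plane *)

Definition unit_vec x := (Num.sqrt (dot x x))^-1 *: x.

Lemma dot_unit_vec x : x != 0 -> dot (unit_vec x) (unit_vec x) = 1.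
Proof.
move=> x0; rewrite dotZl dotC dotZl mulrA -expr2 exprVn sqr_sqrtr ?dotxx_ge0 //.
by rewrite mulVf // dotxx_eq0.
Qed.

Lemma S2_dot (p : S2 R) : dot (sval p) (sval p) = 1.
Proof. by case: p => x /= /set_mem; rewrite /sphere2 /= => <-. Qed.

Lemma S2_neq0 (p : S2 R) : sval p != 0.
Proof. by rewrite -dotxx_eq0 S2_dot oner_eq0. Qed.

Lemma dot_S2 x : dot x x = 1 -> x \in sphere2 R.
Proof. by move=> x1; apply/mem_set; rewrite /sphere2 /= -x1. Qed.

Definition e1_S2 : S2 R.
Proof.
by exists (delta_mx ord0 i0); apply: dot_S2; rewrite dotE !mxE /=; ring.
Defined.

(** The default [e1_S2] is taken only at the zero vector, which has no direction. *)
Definition to_S2 x : S2 R := insubd (e1_S2 : set_type (sphere2 R)) (unit_vec x).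

Lemma to_S2E x : x != 0 -> sval (to_S2 x) = unit_vec x.
Proof. by move=> x0; exact/insubdK/dot_S2/dot_unit_vec. Qed.

Lemma to_S2_sval (p : S2 R) : to_S2 (sval p) = p.
Proof.
by apply: val_inj; rewrite /= to_S2E ?S2_neq0 // /unit_vec S2_dot sqrtr1 invr1 scale1r.
Qed.

Lemma continuous_to_S2 x : x != 0 -> {for x, continuous to_S2}.
Proof.
move=> x0; apply: continuous_subtype => W; rewrite to_S2E //.
have cu : {for x, continuous unit_vec}.
  apply: (@continuousZ R 'rV[R]_3 _ (fun y => (Num.sqrt (dot y y))^-1) id); last exact: cvg_id.
  apply: (@continuousV R _ (fun y => Num.sqrt (dot y y))).
    by rewrite lt0r_neq0 // sqrtr_gt0 dotxx_gt0.
  apply: (@continuous_comp _ _ _ (fun y => dot y y) Num.sqrt); last exact: sqrt_continuous.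
  by apply: continuous_dot; exact: cvg_id.
move=> /cu; rewrite !nbhs_simpl /=; apply: filter_app.
have : \forall y \near x, 0 < dot y y.
  have cd : {for x, continuous (fun y => dot y y)}.
    by apply: continuous_dot; exact: cvg_id.
  exact: (cd _ (lt_nbhsr (dotxx_gt0 x0))).
apply: filterS => y y0 /=; rewrite to_S2E //.
by rewrite -dotxx_eq0 lt0r_neq0.
Qed.

Definition line x : RP2 R := \pi_(RP2 R) (to_S2 x).

Lemma pi_RP2_eq (p p' : S2 R) :
  \pi_(RP2 R) p = \pi_(RP2 R) p' <-> sval p = sval p' \/ sval p = - sval p'.
Proof.
split=> [/eqmodP/orP|h]; first by case=> /eqP ->; [left|right].
by apply/eqmodP/orP; case: h => ->; [left|right].
Qed.

Lemma line_sval (p : S2 R) : line (sval p) = \pi_(RP2 R) p.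
Proof. by rewrite /line to_S2_sval. Qed.

Lemma lineZ a x : a != 0 -> x != 0 -> line (a *: x) = line x.
Proof.
move=> a0 x0; apply/pi_RP2_eq; rewrite !to_S2E ?scaler_eq0 ?negb_or ?a0 //.
rewrite /unit_vec dotZl dotC dotZl mulrA -expr2 sqrtrM ?sqr_ge0 // sqrtr_sqr scalerA invfM mulrAC.
have [a_gt0|a_lt0|/eqP] := ltgtP 0 a; last by rewrite eq_sym (negbTE a0).
  by left; rewrite gtr0_norm // mulVf // mul1r.
by right; rewrite ltr0_norm // invrN mulNr mulVf // mulN1r scaleNr.
Qed.

Lemma line_eq x y : x != 0 -> y != 0 -> line x = line y ->
  exists2 a, a != 0 & x = a *: y.
Proof.
move=> x0 y0 /pi_RP2_eq; rewrite !to_S2E // /unit_vec.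
have sx : Num.sqrt (dot x x) != 0 by rewrite lt0r_neq0 // sqrtr_gt0 dotxx_gt0.
have sy : Num.sqrt (dot y y) != 0 by rewrite lt0r_neq0 // sqrtr_gt0 dotxx_gt0.
set nx := Num.sqrt (dot x x) in sx *; set ny := Num.sqrt (dot y y) in sy *.
move=> h; exists (nx * (if nx^-1 *: x == ny^-1 *: y then 1 else -1) / ny).
  by rewrite !mulf_neq0 ?invr_eq0 //; case: ifP; rewrite ?oppr_eq0 oner_eq0.
apply: (scalerI (invr_neq0 sx)); rewrite scalerA !mulrA mulVf // mul1r -scalerA.
case: ifPn => [/eqP ->|/eqP h']; first by rewrite scale1r.
by case: h => // ->; rewrite scaleN1r.
Qed.

Definition opp_S2 (p : S2 R) : S2 R.
Proof.
exists (- sval p); apply: dot_S2; rewrite -(S2_dot p) !dotE !mxE; ring.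
Defined.

(** The saturation of an open [B] is the union of [B] and its antipode, so the projection is open.
    Nearby lines thus have nearby unit vectors, although [repr] need not pick them. *)
Lemma pi_RP2_open (p : S2 R) (A : set (S2 R)) : nbhs p A ->
  nbhs (\pi_(RP2 R) p) [set \pi_(RP2 R) p' | p' in A].
Proof.
rewrite !nbhsE /= => -[B [oB Bp] BA].
exists [set \pi_(RP2 R) p' | p' in B]; last by move=> _ [p' /BA Ap' <-]; exists p'.
split; last by exists p.
have c_opp : continuous opp_S2.
  move=> r; apply: continuous_subtype; apply: (@continuousN R 'rV[R]_3 (S2 R) (fun s => sval s)).
  exact: (@continuous_sval _ (sphere2 R)).
rewrite /open /= /quotient_open.
have -> : \pi_(RP2 R) @^-1` [set \pi_(RP2 R) p' | p' in B] = B `|` opp_S2 @^-1` B.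
  apply/seteqP; split=> r /=.
    move=> [p' Bp' /pi_RP2_eq [] h]; [left|right].
      by rewrite -(val_inj h : p' = r).
    suff -> : opp_S2 r = p' by [].
    by apply: val_inj; rewrite /= h.
  move=> [Br|Br]; first by exists r.
  by exists (opp_S2 r) => //; apply/pi_RP2_eq; right.
by apply: openU => //; move/continuousP: c_opp; apply.
Qed.

Lemma continuous_line x : x != 0 -> {for x, continuous line}.
Proof.
move=> x0; apply: (@continuous_comp _ _ _ to_S2 \pi_(RP2 R)).
  exact: continuous_to_S2.
exact: pi_continuous.
Qed.

End vectors.

(** * Paths of ordered configurations *)

Section connectivity.
Context (R : realType) (I : finType) (D : {set I}).
Implicit Types (X Y Z : I -> RP2 R).

(** The set [D] will index the two points kept by [forget], so that such a path stays in one
    fibre. *)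
Definition conf_path X Y := exists gamma : R -> I -> RP2 R,
  [/\ forall i, continuous (fun t => gamma t i), forall t, injective (gamma t),
      gamma 0 = X, gamma 1 = Y & forall t i, i \in D -> gamma t i = X i].

Lemma conf_path_refl X : injective X -> conf_path X X.
Proof. by move=> iX; exists (fun=> X); split=> // i; exact: cst_continuous. Qed.

Lemma conf_path_sym X Y : conf_path X Y -> conf_path Y X.
Proof.
move=> [g [cg ig g0 g1 gD]]; exists (fun t => g (1 - t)); split=> //.
- move=> i t; apply: (@continuous_comp R R _ (fun t => 1 - t) (fun t => g t i)).
    by apply: cvgB; [exact: cvg_cst|exact: cvg_id].
  exact: cg.
- by rewrite subr0.
- by rewrite subrr.
- by move=> t i iD; rewrite gD // -g1 gD.
Qed.

Lemma conf_path_trans Y X Z : conf_path X Y -> conf_path Y Z -> conf_path X Z.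
Proof.
move=> [g [cg ig g0 g1 gD]] [h [ch ih h0 h1 hD]].
exists (fun t => if t <= 2^-1 then g (2 * t) else h (2 * t - 1)); split.
- move=> i.
  have -> : (fun t => (if t <= 2^-1 then g (2 * t) else h (2 * t - 1)) i) =
      (fun t : R => if t <= 2^-1 then g (2 * t) i else h (2 * t - 1) i).
    by apply/funext => t; case: ifP.
  apply: (@continuous_glue R R _ id).
  + by move=> t; exact: cvg_id.
  + move=> t; apply: (@continuous_comp R R _ (fun t => 2 * t) (fun t => g t i)).
      by apply: cvgM; [exact: cvg_cst|exact: cvg_id].
    exact: cg.
  + move=> t; apply: (@continuous_comp R R _ (fun t => 2 * t - 1) (fun t => h t i)).
      apply: cvgB; last exact: cvg_cst.
      by apply: cvgM; [exact: cvg_cst|exact: cvg_id].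
    exact: ch.
  + by move=> t ->; rewrite divff ?pnatr_eq0 // subrr g1 h0.
- by move=> t; case: ifP.
- by rewrite ifT ?mulr0 //; lra.
- rewrite ifF; last by apply/negbTE; lra.
  by rewrite -h1; congr h; lra.
- by move=> t i iD; case: ifP => _; rewrite ?gD // hD // -g1 gD.
Qed.

Definition lift_line (l : RP2 R) : 'rV[R]_3 := sval (repr l).

Lemma line_lift l : line (lift_line l) = l.
Proof. by rewrite /lift_line line_sval reprK. Qed.

Lemma lift_neq0 l : lift_line l != 0.
Proof. exact: S2_neq0. Qed.

Definition upd X i l := fun j => if j == i then l else X j.

Definition normal X i j := cross (lift_line (X i)) (lift_line (X j)).

Lemma normal_neq0 X i j : injective X -> j != i -> normal X i j != 0.
Proof.
move=> iX ji; apply: contra ji => /eqP /(cross_eq0 (lift_neq0 _)) h.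
apply/eqP/iX; rewrite -(line_lift (X j)) h lineZ ?line_lift ?lift_neq0 //.
by have := lift_neq0 (X j); rewrite {1}h scaler_eq0 negb_or => /andP[].
Qed.

(* On the segment from [lift_line (X i)] to [z], the functional
   [dot _ (normal X i j)] vanishes only at the start, whereas it kills the
   line [X j]. *)
Lemma conf_path_upd X i z : injective X -> i \notin D -> D != finset.set0 ->
  (forall j, j != i -> dot z (normal X i j) != 0) ->
  conf_path X (upd X i (line z)).
Proof.
move=> iX iD /set0Pn [j0 j0D] zX.
have j0i : j0 != i by apply: contraNneq iD => <-.
pose v (t : R) := (1 - clamp t) *: lift_line (X i) + clamp t *: z.
have dv t j : dot (v t) (normal X i j) = clamp t * dot z (normal X i j).
  by rewrite dotDl !dotZl dot_crossl mulr0 add0r.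
have v_start t : clamp t = 0 -> v t = lift_line (X i).
  by rewrite /v => ->; rewrite subr0 scale1r scale0r addr0.
(* The index [j0] in [D] differs from [i]; its functional shows that the segment misses the origin,
   so that [line (v t)] is meaningful. *)
have v0 t : v t != 0.
  have [/v_start -> //|ct] := eqVneq (clamp t) 0; first exact: lift_neq0.
  apply: contra (zX j0 j0i) => /eqP vt; have := dv t j0; rewrite vt.
  by rewrite -(scale0r 0) dotZl mul0r => /esym/eqP; rewrite mulf_eq0 (negbTE ct).
have vX t j : j != i -> line (v t) <> X j.
  move=> ji; have [/v_start ->|ct] := eqVneq (clamp t) 0.
    by rewrite line_lift => /iX /eqP; rewrite eq_sym (negbTE ji).
  rewrite -(line_lift (X j)) => /(line_eq (v0 t) (lift_neq0 _)) [a _ va].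
  have := dv t j; rewrite va dotZl dot_crossr mulr0 => /esym/eqP.
  by rewrite mulf_eq0 (negbTE ct) (negbTE (zX _ ji)).
exists (fun t => upd X i (line (v t))); split.
- move=> j; rewrite /upd; case: (j == i); last exact: cst_continuous.
  move=> t; apply: (@continuous_comp R _ _ v (@line R)); last exact: continuous_line.
  apply: (@continuousD R 'rV[R]_3 R (fun t => (1 - clamp t) *: lift_line (X i))
    (fun t => clamp t *: z)).
    apply: (@continuousZ R 'rV[R]_3 R (fun t => 1 - clamp t) (fun=> _)); last exact: cvg_cst.
    by apply: cvgB; [exact: cvg_cst|exact: continuous_clamp].
  apply: (@continuousZ R 'rV[R]_3 R (fun t => clamp t) (fun=> z)); last exact: cvg_cst.
  exact: continuous_clamp.
- move=> t j k; rewrite /upd.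
  case: eqVneq => [->|ji]; case: eqVneq => [->//|ki]; last exact: iX.
  + by move/(vX _ _ ki).
  + by move/esym/(vX _ _ ji).
- apply/funext => j; rewrite /upd; case: eqVneq => [->|//].
  by rewrite v_start ?line_lift // clamp_le0.
- by rewrite /v clamp_ge1 // subrr scale0r add0r scale1r.
- by move=> t j jD; rewrite /upd ifF //; apply: contraNF iD => /eqP <-.
Qed.

(** Induction on the number of indices outside a set [E] where the configurations already agree: the
    point [i] is moved in both of them to one common generic line, and [i] joins [E]. *)
Lemma conf_path_exists X Y : injective X -> injective Y -> D != finset.set0 ->
  (forall i, i \in D -> X i = Y i) -> conf_path X Y.
Proof.
move=> iX iY D0.
suff main (E : {set I}) X' Y' : D \subset E -> injective X' -> injective Y' ->
    (forall i, i \in E -> X' i = Y' i) -> conf_path X' Y' by exact: (main D).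
move: {2}#|~: E| (leqnn #|~: E|) => n.
elim: n E X' Y' {X Y iX iY} => [|n IHn] E X Y En DE iX iY XY.
  have -> : Y = X; last exact: conf_path_refl.
  apply/funext => i; rewrite XY //; apply: contraLR En => iE.
  by rewrite -ltnNge card_gt0; apply/set0Pn; exists i; rewrite inE.
have [EC0|[i]] := set_0Vmem (~: E).
  by apply: (IHn E) => //; rewrite EC0 cards0.
rewrite inE => iE.
have iD : i \notin D by apply: contra iE; exact: (fintype.subsetP DE).
(* The vector [z] is to lie off every plane spanned by the line [i] and another line of either
   configuration, so that both moves avoid collisions. *)
have : 0 \notin [seq normal X i j | j <- enum I & j != i] ++
    [seq normal Y i j | j <- enum I & j != i].
  rewrite mem_cat; apply/norP.
  by split; apply/mapP => -[j]; rewrite mem_filter => /andP[ji _] /esym/eqP;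
    apply/negP/normal_neq0.
move=> /generic_vector [z zP].
have pX : conf_path X (upd X i (line z)).
  apply: conf_path_upd => // j ji; apply: zP; rewrite mem_cat.
  by apply/orP; left; apply: map_f; rewrite mem_filter ji mem_enum.
have pY : conf_path Y (upd Y i (line z)).
  apply: conf_path_upd => // j ji; apply: zP; rewrite mem_cat.
  by apply/orP; right; apply: map_f; rewrite mem_filter ji mem_enum.
apply: (conf_path_trans pX); apply: conf_path_trans (conf_path_sym pY).
(* The ends of the two paths provide the injectivity of the updated configurations. *)
have [gX [_ igX _ gX1 _]] := pX; have [gY [_ igY _ gY1 _]] := pY.
apply: (IHn (i |: E)).
- rewrite -ltnS; apply: leq_trans En; apply: proper_card.
  apply/properP; split; first by rewrite finset.setCS finset.subsetUr.
  by exists i; rewrite !inE ?eqxx.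
- exact: fintype.subset_trans DE (finset.subsetUr _ _).
- by rewrite -gX1; exact: igX.
- by rewrite -gY1; exact: igY.
- by move=> j; rewrite !inE /upd; case: eqVneq => //= _; exact: XY.
Qed.

End connectivity.

(** * Invariant families of lines *)

Section orbits.
Context (R : realType) (m : nat).
Implicit Types (u v : 'rV[R]_3).

(* The summands index the line w, the pair u + v, u - v, and the quadruples
   u + t w, u - t w, v + t w, v - t w for t = 1, ..., m / 4. *)
Definition orbit_pt : finType :=
  ('I_(odd m) + 'I_(odd m./2) * bool + 'I_(m./2./2) * bool * bool)%type.

(** The families have 1, 2 and 4 members, and m = b0 + 2 b1 + 4 (m / 4), where b0 and b1 are the
    last two binary digits of m. *)
Lemma card_orbit_pt : #|orbit_pt| = m.
Proof.
rewrite !card_sum !card_prod !card_ord card_bool -mulnA.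
by have := odd_double_half m; have := odd_double_half m./2; lia.
Qed.

(** In the pair, [b] gives the sign of v. In a quadruple, [b] selects u or v and [c] gives the sign
    of t w, where [t = j.+1] never vanishes. *)
Definition coord_u (x : orbit_pt) : R := match x with
  | inl (inl _) => 0 | inl (inr _) => 1 | inr (_, b, _) => (b : nat)%:R end.
Definition coord_v (x : orbit_pt) : R := match x with
  | inl (inl _) => 0 | inl (inr (_, b)) => (-1) ^+ b
  | inr (_, b, _) => (~~ b : nat)%:R end.
Definition coord_w (x : orbit_pt) : R := match x with
  | inl (inl _) => 1 | inl (inr _) => 0
  | inr (j, _, c) => (-1) ^+ c * j.+1%:R end.

Lemma ord_bool_eq (b : bool) (i j : 'I_b) : i = j.
Proof. by apply: val_inj; case: b i j => [] [[|i] hi] [[|j] hj]. Qed.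

Lemma signr_inj : injective (fun b : bool => (-1) ^+ b : R).
Proof. by move=> [] [] //=; rewrite expr0 expr1 => h; exfalso; lra. Qed.

Lemma sgn_nat_neq0 (c : bool) j : (-1) ^+ c * j.+1%:R != 0 :> R.
Proof. by rewrite mulf_neq0 ?signr_eq0 // pnatr_eq0. Qed.

(** With the independence of u, v, w this makes the added lines distinct. Between quadruples, the
    coordinates on u and v give [b] and force [l = 1]; then the one on w gives [j] by its absolute
    value and [c] by its sign. *)
Lemma coord_inj (x y : orbit_pt) (l : R) : coord_u x = l * coord_u y ->
  coord_v x = l * coord_v y -> coord_w x = l * coord_w y -> x = y.
Proof.
case: x => [[k|[k b]]|[[j b] c]]; case: y => [[k'|[k' b']]|[[j' b'] c']] /=.
- by rewrite (ord_bool_eq k k').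
- by move=> _ _ h; exfalso; lra.
- move=> h1 h2; have -> : l = 0 by move: h1 h2; case: b' => /=; lra.
  by move=> h; exfalso; lra.
- by move=> h; exfalso; lra.
- move=> h1; have -> : l = 1 by lra.
  by rewrite mul1r => /signr_inj -> _; rewrite (ord_bool_eq k k').
- move=> h1 _ /esym/eqP; rewrite mulf_eq0 (negbTE (sgn_nat_neq0 _ _)) orbF => /eqP l0.
  by move: h1; rewrite l0 => h; exfalso; lra.
- by case: b => /= h1 h2; exfalso; lra.
- by move=> _ _ /eqP; rewrite mulr0 (negbTE (sgn_nat_neq0 _ _)).
- move=> h1 h2.
  have bb : b = b' by move: b b' h1 h2 => [] [] //= h1 h2; exfalso; lra.
  have -> : l = 1 by move: h1 h2; rewrite bb; case: (b') => /=; lra.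
  rewrite mul1r bb => h3.
  have := congr1 (fun r : R => `|r|) h3.
  rewrite !normrM !normr_sign !mul1r !normr_nat => /eqP; rewrite eqr_nat => /eqP [] jj.
  have -> : j = j' by exact: val_inj.
  move: h3; rewrite jj => /mulIf; rewrite pnatr_eq0 => /(_ isT) /signr_inj -> //.
Qed.

(** Keeps the added lines off the line of u, as [coord_uw] does for v. *)
Lemma coord_vw x : coord_v x = 0 -> coord_w x = 0 -> False.
Proof.
case: x => [[k|[k b]]|[[j b] c]] /=; first by lra.
  by move=> /eqP; rewrite signr_eq0.
by move=> _ /eqP; rewrite (negbTE (sgn_nat_neq0 _ _)).
Qed.

Lemma coord_uw x : coord_u x = 0 -> coord_w x = 0 -> False.
Proof.
case: x => [[k|[k b]]|[[j b] c]] /=; [lra|lra|].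
by move=> _ /eqP; rewrite (negbTE (sgn_nat_neq0 _ _)).
Qed.

Definition orbit_vec u v x :=
  coord_u x *: u + coord_v x *: v + coord_w x *: cross u v.

(** The vector w changes sign with u. Hence the lines of u + v and u - v are exchanged, so are those
    of v + t w and v - t w, and the others are fixed. *)
Lemma orbit_vecN u v x : exists y,
  orbit_vec (- u) v x = orbit_vec u v y \/ orbit_vec (- u) v x = - orbit_vec u v y.
Proof.
rewrite /orbit_vec crossNl.
case: x => [[k|[k b]]|[[j [] c]]] /=.
- exists (inl (inl k)); right => /=; apply: row3P; rewrite !mxE /=; ring.
- exists (inl (inr (k, ~~ b))); right; rewrite /= signrN.
  apply: row3P; rewrite !mxE /=; ring.
- exists (inr (j, true, c)); right => /=; apply: row3P; rewrite !mxE /=; ring.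
- exists (inr (j, false, ~~ c)); left; rewrite /= signrN.
  apply: row3P; rewrite !mxE /=; ring.
Qed.

(** The exchange turns w into - w, so that u + t w becomes v - t w, while u - v becomes its
    opposite. *)
Lemma orbit_vecC u v x : exists y,
  orbit_vec v u x = orbit_vec u v y \/ orbit_vec v u x = - orbit_vec u v y.
Proof.
rewrite /orbit_vec (crossC v u).
case: x => [[k|[k b]]|[[j b] c]] /=.
- exists (inl (inl k)); right => /=; apply: row3P; rewrite !mxE /=; ring.
- exists (inl (inr (k, b))); case: b; [right|left] => /=;
  apply: row3P; rewrite !mxE /=; ring.
- exists (inr (j, ~~ b, ~~ c)); left; rewrite /= signrN negbK.
  apply: row3P; rewrite !mxE /=; ring.
Qed.

Definition frame u v := [/\ dot u u = 1, dot v v = 1, u != v & u != - v].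

Lemma frameC u v : frame u v -> frame v u.
Proof.
case=> uu vv uv uNv; split=> //; first by rewrite eq_sym.
by apply: contra uNv => /eqP ->; rewrite opprK.
Qed.

Lemma frameN u v : frame u v -> frame (- u) v.
Proof.
case=> uu vv uv uNv; split=> //; last by rewrite eqr_opp.
  by rewrite -uu !dotE !mxE; ring.
by rewrite eqr_oppLR.
Qed.

Lemma frame_neq0l u v : frame u v -> u != 0.
Proof. by case=> uu _ _ _; rewrite -dotxx_eq0 uu oner_eq0. Qed.

Lemma frame_S2 (p r : S2 R) : \pi_(RP2 R) p <> \pi_(RP2 R) r -> frame (sval p) (sval r).
Proof.
move=> pr; split; try exact: S2_dot.
  by apply/eqP => h; apply/pr/pi_RP2_eq; left.
by apply/eqP => h; apply/pr/pi_RP2_eq; right.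
Qed.

(** Three cases at once: the zero vector for [a = b = 0], the multiples of u for [b = 0], those of v
    for [a = 0]. *)
Lemma orbit_vec_neq u v x (a b : R) : frame u v -> a = 0 \/ b = 0 ->
  orbit_vec u v x <> a *: u + b *: v.
Proof.
case=> uu vv uv uNv ab /eqP; rewrite -subr_eq0 => /eqP h.
have := @frame_free _ u v (coord_u x - a) (coord_v x - b) (coord_w x) uu vv uv uNv.
case=> [|h1 h2 h3].
  by rewrite -h /orbit_vec; apply: row3P; rewrite !mxE /=; ring.
case: ab => ab; first by apply: (@coord_uw x) => //; lra.
by apply: (@coord_vw x) => //; lra.
Qed.

Lemma orbit_vec_neq0 u v x : frame u v -> orbit_vec u v x != 0.
Proof.
move=> fuv; apply/eqP => h; apply: (@orbit_vec_neq u v x 0 0) => //; first by left.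
by rewrite h !scale0r addr0.
Qed.

Lemma line_orbit_vec_inj u v : frame u v -> injective (fun x => line (orbit_vec u v x)).
Proof.
move=> fuv x y /(line_eq (orbit_vec_neq0 _ fuv) (orbit_vec_neq0 _ fuv)) [l _ h].
case: fuv => uu vv uv uNv.
have := @frame_free _ u v (coord_u x - l * coord_u y) (coord_v x - l * coord_v y)
  (coord_w x - l * coord_w y) uu vv uv uNv.
case=> [|/subr0_eq h1 /subr0_eq h2 /subr0_eq h3]; last exact: coord_inj h1 h2 h3.
move/eqP: h; rewrite -subr_eq0 => /eqP <-; rewrite /orbit_vec.
by apply: row3P; rewrite !mxE /=; ring.
Qed.

Lemma line_orbit_vec_neql u v x : frame u v -> line (orbit_vec u v x) <> line u.
Proof.
move=> fuv /(line_eq (orbit_vec_neq0 _ fuv) (frame_neq0l fuv)) [l _ h].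
by apply: (@orbit_vec_neq u v x l 0) => //; [right|rewrite scale0r addr0].
Qed.

Lemma line_orbit_vec_neqr u v x : frame u v -> line (orbit_vec u v x) <> line v.
Proof.
move=> fuv /(line_eq (orbit_vec_neq0 _ fuv) (frame_neq0l (frameC fuv))) [l _ h].
by apply: (@orbit_vec_neq u v x 0 l) => //; [left|rewrite scale0r add0r].
Qed.

Lemma line_frame_neq u v : frame u v -> line u <> line v.
Proof.
move=> fuv; case: (fuv) => uu vv uv uNv.
move=> /(line_eq (frame_neq0l fuv) (frame_neq0l (frameC fuv))) [l _ h].
have [] := @frame_free _ u v 1 (- l) 0 uu vv uv uNv.
  by rewrite {1}h; apply: row3P; rewrite !mxE /=; ring.
by move=> /eqP; rewrite oner_eq0.
Qed.

Definition orbit_idx (k : 'I_m) : orbit_pt := enum_val (cast_ord (esym card_orbit_pt) k).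

Lemma orbit_idx_inj : injective orbit_idx.
Proof. by move=> j k /enum_val_inj /cast_ord_inj. Qed.

Lemma orbit_idx_surj x : exists k, orbit_idx k = x.
Proof.
exists (cast_ord card_orbit_pt (enum_rank x)).
by rewrite /orbit_idx cast_ordK enum_rankK.
Qed.

Definition frame_conf u v : 'I_(2 + m) -> RP2 R := fun i =>
  match fintype.split i with
  | inl j => if j == ord0 then line u else line v
  | inr k => line (orbit_vec u v (orbit_idx k))
  end.

Lemma frame_conf_inj u v : frame u v -> injective (frame_conf u v).
Proof.
move=> fuv i j; rewrite /frame_conf.
have ord2 (a b : 'I_2) : (a == ord0) = (b == ord0) -> a = b.
  by move: a b => [[|[|//]] ha] [[|[|//]] hb] // _; apply: val_inj.
rewrite -{2}(splitK i) -{2}(splitK j).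
case: (fintype.split i) => a; case: (fintype.split j) => b.
- case: ifP => ha; case: ifP => hb h.
  + by rewrite (ord2 a b) // ha hb.
  + by case: (line_frame_neq fuv).
  + by case: (line_frame_neq fuv).
  + by rewrite (ord2 a b) // ha hb.
- by case: ifP => _ /esym; [move/(line_orbit_vec_neql fuv)|move/(line_orbit_vec_neqr fuv)].
- by case: ifP => _; [move/(line_orbit_vec_neql fuv)|move/(line_orbit_vec_neqr fuv)].
- by move/(line_orbit_vec_inj fuv)/orbit_idx_inj => ->.
Qed.

End orbits.
Arguments orbit_vec {R} m u v x.
Arguments frame_conf {R} m u v.

(** * The continuous section *)

(** Between injective configurations, this blockwise inclusion already amounts to equality of
    classes in [Conf], and it spares explicit permutations. *)
Definition sub_conf (R : realType) (n m : nat) (X Y : 'I_(n + m) -> RP2 R) :=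
  forall i, exists j, X i = Y j /\ (j < n)%N = (i < n)%N.

Lemma sub_conf_trans (R : realType) (n m : nat) (Y X Z : 'I_(n + m) -> RP2 R) :
  sub_conf X Y -> sub_conf Y Z -> sub_conf X Z.
Proof.
move=> XY YZ i; have [j [-> <-]] := XY i; have [k [-> <-]] := YZ j.
by exists k.
Qed.

(** The chosen index map is injective because [q] is, hence a permutation; as it respects the
    blocks, it lies in [young n m]. *)
Lemma pi_Conf_eq (R : realType) (n m : nat) (p q : FConf R (n + m)) :
  sub_conf (sval q) (sval p) -> \pi_(Conf R n m) p = \pi_(Conf R n m) q.
Proof.
move=> /choice [s sP]; apply/eqmodP/asboolP.
have s_inj : injective s.
  move=> i j sij; have /set_mem /= := svalP q; apply.
  by rewrite (sP i).1 (sP j).1 sij.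
exists (perm s_inj) => [|i]; last by rewrite permE (sP i).1.
rewrite !inE; apply/fintype.subsetP => i; rewrite !inE /= apermE permE.
by rewrite (sP i).2.
Qed.

(** The permutation relating [p] to the representative used by [forget] preserves the first [n]
    indices, hence restricts to a permutation of them. *)
Lemma forget_pi (R : realType) (n m : nat) (p : FConf R (n + m)) :
  forget R n m (\pi_(Conf R n m) p) = \pi_(UConf R n) (restr R n m p).
Proof.
rewrite /forget; set r := repr _.
have /eqmodP/asboolP [s sY rp] : \pi_(Conf R n m) r = \pi_(Conf R n m) p by rewrite reprK.
have sn i : (s i < n)%N = (i < n)%N.
  have /(_ i) := astabsP sY.
  by rewrite !inE /= apermE.
have /choice [t tP] : forall i : 'I_n, exists j, s (lshift m i) = lshift m j.
  move=> i; have h : (s (lshift m i) < n)%N by rewrite sn /=.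
  by exists (Ordinal h); apply: val_inj.
have t_inj : injective t.
  by move=> i j tij; apply: (@lshift_inj n m); apply: (@perm_inj _ s); rewrite !tP tij.
apply/eqmodP/asboolP; exists (perm t_inj); first by rewrite inE.
by move=> i /=; rewrite permE -tP rp.
Qed.

Definition mk_conf (R : realType) (k : nat) (X : 'I_k -> RP2 R)
    (iX : injective X) : FConf R k :=
  exist _ X (mem_set (iX : [set f : 'I_k -> RP2 R | injective f] X)).

Section geometric_section.
Context (R : realType) (m : nat).
Implicit Types (u v : 'rV[R]_3).

Lemma lineN (x : 'rV[R]_3) : x != 0 -> line (- x) = line x.
Proof. by move=> x0; rewrite -scaleN1r lineZ // oppr_eq0 oner_eq0. Qed.

Lemma frame_conf_l u v j :
  frame_conf m u v (lshift m j) = if j == ord0 then line u else line v.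
Proof. by rewrite /frame_conf -[lshift m j]/(unsplit (inl j)) unsplitK. Qed.

Lemma frame_conf_r u v k :
  frame_conf m u v (rshift 2 k) = line (orbit_vec m u v (orbit_idx k)).
Proof. by rewrite /frame_conf -[rshift 2 k]/(unsplit (inr k)) unsplitK. Qed.

Lemma ord2P (i : 'I_2) : i = ord0 \/ i = ord_max.
Proof. by case: i => -[|[|//]] h; [left|right]; apply: val_inj. Qed.

Lemma frame_conf_sub_gen u v (u' v' : 'rV[R]_3) : frame u v ->
  (line u' = line u /\ line v' = line v) \/ (line u' = line v /\ line v' = line u) ->
  (forall x, exists y, orbit_vec m u' v' x = orbit_vec m u v y \/
    orbit_vec m u' v' x = - orbit_vec m u v y) ->
  sub_conf (frame_conf m u' v') (frame_conf m u v).
Proof.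
move=> fuv uv orb i; case: (split_ordP i) => j ->.
  case: uv => -[lu lv].
    exists (lshift m j); split; last exact: (ltn_ord j).
    by rewrite !frame_conf_l lu lv.
  exists (lshift m (rev_ord j)); split; last exact: (ltn_ord (rev_ord j)).
  rewrite !frame_conf_l lu lv.
  by have [->|->] := ord2P j.
have [y hy] := orb (orbit_idx j); have [k ky] := orbit_idx_surj y.
exists (rshift 2 k); split=> //; rewrite !frame_conf_r ky.
by case: hy => ->; rewrite // lineN //; exact: orbit_vec_neq0.
Qed.

Lemma frame_confN u v : frame u v -> sub_conf (frame_conf m (- u) v) (frame_conf m u v).
Proof.
move=> fuv; apply: frame_conf_sub_gen => //; last exact: orbit_vecN.
by left; rewrite lineN // (frame_neq0l fuv).
Qed.

Lemma frame_confC u v : frame u v -> sub_conf (frame_conf m v u) (frame_conf m u v).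
Proof.
by move=> fuv; apply: frame_conf_sub_gen => //; [right|exact: orbit_vecC].
Qed.

Lemma line_unit_eq (x y : 'rV[R]_3) : dot x x = 1 -> dot y y = 1 ->
  line x = line y -> x = y \/ x = - y.
Proof.
move=> xx yy /line_eq []; rewrite -?dotxx_eq0 ?xx ?yy ?oner_eq0 // => a _ xay.
move: xx; rewrite xay dotZl dotC dotZl yy mulr1 => /eqP.
rewrite -expr2 sqrf_eq1 => /orP[] /eqP ->; first by left; rewrite scale1r.
by right; rewrite scaleN1r.
Qed.

(** A line determines its unit vector up to sign, so the two frames differ by sign changes and
    possibly an exchange. *)
Lemma frame_conf_sub u v (u' v' : 'rV[R]_3) : frame u v -> frame u' v' ->
  (line u' = line u /\ line v' = line v) \/ (line u' = line v /\ line v' = line u) ->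
  sub_conf (frame_conf m u' v') (frame_conf m u v).
Proof.
move=> fuv fuv'.
suff same x y : frame x y -> line u' = line x -> line v' = line y ->
    sub_conf (frame_conf m u' v') (frame_conf m x y).
  case=> -[lu lv]; first exact: same.
  by apply: (sub_conf_trans (same _ _ (frameC fuv) lu lv)); exact: frame_confC.
move=> fxy lu lv; case: fuv' => uu vv _ _; case: (fxy) => xx yy _ _.
(* A sign change of the second vector is a sign change of the first conjugated by the exchange. *)
have negr : sub_conf (frame_conf m x (- y)) (frame_conf m x y).
  apply: (sub_conf_trans (frame_confC (frameN (frameC fxy)))).
  apply: (sub_conf_trans (frame_confN (frameC fxy))).
  exact: frame_confC.
have [->|->] := line_unit_eq uu xx lu; have [->|->] := line_unit_eq vv yy lv.
- by move=> i; exists i.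
- exact: negr.
- exact: frame_confN.
- apply: sub_conf_trans negr; apply: frame_confN.
  exact/frameC/frameN/frameC.
Qed.

Lemma FConf2_neq (p : FConf R 2) : sval p ord0 <> sval p ord_max.
Proof. by have /set_mem /= inj := svalP p; move=> /inj. Qed.

Lemma FConf2_frame (p : FConf R 2) :
  frame (lift_line (sval p ord0)) (lift_line (sval p ord_max)).
Proof. by apply: frame_S2; rewrite !reprK; exact: FConf2_neq. Qed.

(** The result depends on the unit vectors picked by [repr]; its class in [Conf] does not, and it is
    this class that varies continuously. *)
Definition add_orbits (p : FConf R 2) : FConf R (2 + m) :=
  mk_conf (@frame_conf_inj R m _ _ (FConf2_frame p)).

Lemma restr_add_orbits p : restr R 2 m (add_orbits p) = p.
Proof.
apply: val_inj; apply/funext => i /=; rewrite frame_conf_l !line_lift; case: eqVneq => [->//|i0].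
by congr (sval p _); apply: val_inj; case: i i0 => -[|[|//]].
Qed.

Definition sect (c : UConf R 2) : Conf R 2 m := \pi_(Conf R 2 m) (add_orbits (repr c)).

Lemma sectK : cancel sect (forget R 2 m).
Proof. by move=> c; rewrite /sect forget_pi restr_add_orbits reprK. Qed.

Lemma sect_pi p : sect (\pi_(UConf R 2) p) = \pi_(Conf R 2 m) (add_orbits p).
Proof.
rewrite /sect; set r := repr _.
have /eqmodP/asboolP [s _ rp] : \pi_(UConf R 2) r = \pi_(UConf R 2) p by rewrite reprK.
apply: pi_Conf_eq; apply: frame_conf_sub; try exact: FConf2_frame.
rewrite !line_lift !rp.
have [s0|s0] := ord2P (s ord0); have [s1|s1] := ord2P (s ord_max); rewrite s0 s1.
- by have /perm_inj := etrans s0 (esym s1).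
- by left.
- by right.
- by have /perm_inj := etrans s0 (esym s1).
Qed.

Lemma continuous_frame_conf (a b : S2 R) i : frame (sval a) (sval b) ->
  {for (a, b), continuous (fun z : S2 R * S2 R => frame_conf m (sval z.1) (sval z.2) i)}.
Proof.
move=> fab; rewrite /frame_conf.
have cfst : {for (a, b), continuous (fun z : S2 R * S2 R => sval z.1 : 'rV[R]_3)}.
  apply: (@continuous_comp _ (S2 R) _ fst (fun p => sval p : 'rV[R]_3)); first exact: cvg_fst.
  exact: (@continuous_sval _ (sphere2 R)).
have csnd : {for (a, b), continuous (fun z : S2 R * S2 R => sval z.2 : 'rV[R]_3)}.
  apply: (@continuous_comp _ (S2 R) _ snd (fun p => sval p : 'rV[R]_3)); first exact: cvg_snd.
  exact: (@continuous_sval _ (sphere2 R)).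
have cl (f : S2 R * S2 R -> 'rV[R]_3) : {for (a, b), continuous f} -> f (a, b) != 0 ->
    {for (a, b), continuous (fun z => line (f z))}.
  move=> cf f0; apply: (@continuous_comp _ _ _ f (@line R)) => //.
  exact: continuous_line.
case: (fintype.split i) => j.
  case: (j == ord0).
    exact: (cl (fun z => sval z.1) cfst (S2_neq0 _)).
  exact: (cl (fun z => sval z.2) csnd (S2_neq0 _)).
apply: (cl (fun z => orbit_vec m (sval z.1) (sval z.2) (orbit_idx j)));
  last exact: orbit_vec_neq0.
have cZ (r : R) (f : S2 R * S2 R -> 'rV[R]_3) : {for (a, b), continuous f} ->
    {for (a, b), continuous (fun z => r *: f z)}.
  by move=> cf; apply: (@continuousZ R 'rV[R]_3 _ (fun=> r) f) => //; exact: cvg_cst.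
have cD (f g : S2 R * S2 R -> 'rV[R]_3) : {for (a, b), continuous f} ->
    {for (a, b), continuous g} -> {for (a, b), continuous (fun z => f z + g z)}.
  by move=> cf cg; exact: (@continuousD R 'rV[R]_3 _ f g).
exact: (cD _ _ (cD _ _ (cZ _ _ cfst) (cZ _ _ csnd))
  (cZ _ _ (continuous_cross cfst csnd))).
Qed.

Lemma continuous_coord (k : nat) (i : 'I_k) : continuous (fun p : FConf R k => sval p i).
Proof.
move=> p; apply: (@continuous_comp (FConf R k) (prod_topology (fun _ : 'I_k => RP2 R)) _
  (fun p => sval p) (fun X => X i)); first exact: continuous_sval.
exact: (@proj_continuous _ (fun _ : 'I_k => RP2 R) i).
Qed.

(** Locally, [repr] is replaced by unit vectors close to the fixed ones [a] and [b], which exist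
    because the projection of the sphere is open; [frame_conf] is continuous in these. *)
Lemma continuous_sect : continuous sect.
Proof.
apply/quotient_continuous => p W /=; rewrite sect_pi => /pi_continuous.
move=> [_ [[C oC <-] Cp] CW].
set a := repr (sval p ord0); set b := repr (sval p ord_max).
have fab : frame (sval a) (sval b) := FConf2_frame p.
have cF : {for (a, b), continuous (fun z : S2 R * S2 R =>
    frame_conf m (sval z.1) (sval z.2) : prod_topology (fun _ : 'I_(2 + m) => RP2 R))}.
  by apply: continuous_prod => i; exact: continuous_frame_conf.
have [[A B] [nA nB] AB] := cF C (open_nbhs_nbhs (conj oC Cp)).
have nA' := @continuous_coord 2 ord0 p _ _; have nB' := @continuous_coord 2 ord_max p _ _.
have {nA'} := nA' [set \pi_(RP2 R) x | x in A] _.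
have {nB'} := nB' [set \pi_(RP2 R) x | x in B] _.
rewrite -{1}(reprK (sval p ord0)) -{1}(reprK (sval p ord_max)).
move=> /(_ (pi_RP2_open nB)) hB /(_ (pi_RP2_open nA)) hA.
rewrite !nbhs_simpl /= in hA hB *.
apply: filter_app hA; apply: filterS hB => p' [b' Bb' pb] [a' Aa' pa] /=.
have fab' : frame (sval a') (sval b').
  by apply: frame_S2; rewrite pa pb; exact: FConf2_neq.
(* Unlike [add_orbits p'], the representative [q'] is sure to lie in the neighbourhood [C]; both
   have the same class. *)
pose q' : FConf R (2 + m) := mk_conf (@frame_conf_inj R m _ _ fab').
rewrite sect_pi (_ : \pi_(Conf R 2 m) (add_orbits p') = \pi_(Conf R 2 m) q').
  by apply: (CW q'); exact: (AB (a', b')).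
apply: pi_Conf_eq; apply: frame_conf_sub => //; first exact: FConf2_frame.
by left; rewrite !line_lift !line_sval pa pb.
Qed.

(** The representatives [p0] and [p1] share their first two points; moving the other [m] while these
    are held fixed never leaves the fibre. *)
Lemma fibre_path (y0 : Conf R 2 m) : exists gamma : R -> Conf R 2 m,
  [/\ continuous gamma, gamma 0 = y0, gamma 1 = sect (forget R 2 m y0)
    & forall t, forget R 2 m (gamma t) = forget R 2 m y0].
Proof.
pose p0 := repr y0; pose p1 := add_orbits (restr R 2 m p0).
have /set_mem /= i0 := svalP p0; have /set_mem /= i1 := svalP p1.
pose D := [set i : 'I_(2 + m) | (i < 2)%N]%SET.
have [|i|g [cg ig g0 g1 gD]] := @conf_path_exists R _ D _ _ i0 i1.
- by apply/set0Pn; exists ord0; rewrite inE.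
- rewrite inE => i2; have -> : i = lshift m (Ordinal i2) by exact: val_inj.
  by have := congr1 (fun p => sval p (Ordinal i2)) (restr_add_orbits (restr R 2 m p0)).
pose G t : FConf R (2 + m) := mk_conf (ig t).
have rG t : restr R 2 m (G t) = restr R 2 m p0.
  by apply: val_inj; apply/funext => i /=; rewrite gD // inE; exact: (ltn_ord i).
exists (fun t => \pi_(Conf R 2 m) (G t)); split.
- move=> t; apply: (@continuous_comp R (FConf R (2 + m)) (Conf R 2 m) G).
    by apply: continuous_subtype; apply: continuous_prod => i; exact: cg.
  exact: pi_continuous.
- by rewrite -[RHS]reprK; congr (\pi_(Conf R 2 m) _); apply: val_inj.
- rewrite sect_pi; congr (\pi_(Conf R 2 m) _); exact: val_inj.
- by move=> t; rewrite forget_pi rG.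
Qed.

End geometric_section.

Theorem theoremA (R : realType) (m : nat) (y0 : Conf R 2 m) :
  exists s : (R -> UConf R 2) -> (R -> Conf R 2 m),
    pi1_section (forget R 2 m) y0 s.
Proof.
have [gamma [cgamma gamma0 gamma1 q_gamma]] := fibre_path y0.
exists (lift_loop (@sect R m) gamma).
by apply: pi1_section_lift_loop => //; [exact: continuous_sect|exact: sectK].
Qed.
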